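(* Let $M_k$ be the submatrix of $M$ consisting of the rows indexed by the working set $\mathcal{W}_k$. Assume that $M_k M_k^T = L D L^T$, where $L$ is lower unit triangular and $D$ is diagonal, with the $i$th diagonal element of $D$ being zero, i.e., $$L = \begin{bmatrix} L_1 & 0 & 0\\ l_i^T & 1 & 0\\ * & * & *\end{bmatrix},\qquad D=\begin{bmatrix} D_1 & 0 & 0\\ 0&0&0\\ 0&0&D_2\end{bmatrix},$$ where the middle block row and the middle block column are the $i$th row and $i$th column, respectively, and $*$ denotes unspecified blocks. Let $\tilde p$ be the solution to $L_1^T\tilde p = -l_i$. Then $p = \begin{bmatrix}\tilde p^T & 1 & 0\end{bmatrix}^T$ satisfies $M_kM_k^Tp=0$.
   Context: Let $H\in\mathbb{R}^{n\times n}$ be symmetric positive definite, $A\in\mathbb{R}^{m\times n}$, let $R$ be an upper triangular Cholesky factor of $H$ (so $H=R^TR$), and set $M = A R^{-1}\in\mathbb{R}^{m\times n}$. The working set $\mathcal{W}_k\subseteq\{1,\dots,m\}$ is an arbitrary set of row indices, and $M_k$ denotes the matrix formed by the rows of $M$ indexed by $\mathcal{W}_k$ (in some fixed order). ''Lower unit triangular'' means lower triangular with all diagonal entries equal to $1$. In the block partition, $L_1$ and $D_1$ are of size $(i-1)\times(i-1)$ ($L_1$ lower unit triangular, $D_1$ diagonal), $l_i\in\mathbb{R}^{i-1}$, $D_2$ is diagonal, and in $p$ the entry $1$ is in position $i$ and the trailing $0$ is a zero vector of length $|\mathcal{W}_k|-i$. *)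

(* Defs.v *)
From mathcomp Require Import all_boot all_order all_algebra.
From mathcomp Require Import reals.

Set Implicit Arguments.
Unset Strict Implicit.
Unset Printing Implicit Defensive.

Import Order.TTheory GRing.Theory Num.Theory.
Local Open Scope ring_scope.

Definition sym_posdef (F : realType) (n : nat) (H : 'M[F]_n) : Prop :=
  H^T = H /\ forall x : 'cV[F]_n, x != 0 -> 0 < (x^T *m H *m x) 0 0.

(* [is_trig_mx] is lower triangularity. No sign condition is put on the
   diagonal of [R]. *)
Definition cholesky_factor (F : realType) (n : nat) (H R : 'M[F]_n) : Prop :=
  is_trig_mx R^T /\ H = R^T *m R.

Definition lower_unit_trig (F : realType) (q : nat) (L : 'M[F]_q) : Prop :=
  is_trig_mx L /\ forall a : 'I_q, L a a = 1.

(* [w] lists the elements of [W], each exactly once, in some order; hence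
   [#|W| = q]. *)
Definition enumerates (m q : nat) (W : {set 'I_m}) (w : 'I_q -> 'I_m) : Prop :=
  injective w /\ W = [set w a | a : 'I_q].

(* Matrices of order [j + (1 + r)] are partitioned in blocks of sizes
   [j], [1] and [r]; the middle row and column have this (0-based) index [j],
   i.e. they are number [i = j + 1] when counting from 1. *)
Definition mid_index (j r : nat) : 'I_(j + (1 + r)) :=
  rshift j (lshift r (ord0 : 'I_1)).

Definition block_L1 (F : realType) (j r : nat) (L : 'M[F]_(j + (1 + r))) :
  'M[F]_j := ulsubmx L.

Definition block_li (F : realType) (j r : nat) (L : 'M[F]_(j + (1 + r))) :
  'cV[F]_j := (usubmx (dlsubmx L : 'M[F]_(1 + r, j)))^T.

(* Main.v *)
(* The equation for [pt] makes [L^T *m p] vanish on the leading block, and lower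
   triangularity makes it vanish on the trailing one; so [L^T *m p] is supported
   at the middle index, where [D] is zero. *)

Require Import Defs.
From mathcomp Require Import all_boot all_order all_algebra.
From mathcomp Require Import reals.

Set Implicit Arguments.
Unset Strict Implicit.
Unset Printing Implicit Defensive.

Import Order.TTheory GRing.Theory Num.Theory.
Local Open Scope ring_scope.

(** The trailing zeros of the vector hide the unspecified last block row of [L], and its entry 1
    picks out the middle row. *)
Lemma mul_trmx_col_mid (F : pzSemiRingType) (j r : nat)
    (L : 'M[F]_(j + (1 + r))) (pt : 'cV[F]_j) (a : 'I_(j + (1 + r))) :
  (L^T *m col_mx pt (col_mx (1%:M : 'cV[F]_1) (0 : 'cV[F]_r))) a 0 =
  \sum_(b < j) L (lshift (1 + r) b) a * pt b 0 + L (mid_index j r) a.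
Proof.
rewrite mxE big_split_ord /= big_split_ord /= big_ord1.
under eq_bigr do rewrite mxE col_mxEu.
rewrite col_mxEd col_mxEu [X in _ + (_ + X)]big1 ?addr0 => [|b _].
  by congr (_ + _); rewrite !mxE mulr1.
by rewrite !col_mxEd [X in _ * X]mxE mulr0.
Qed.

Lemma trmx_col_mid_eq0 (F : realType) (j r : nat)
    (L : 'M[F]_(j + (1 + r))) (pt : 'cV[F]_j) (a : 'I_(j + (1 + r))) :
  is_trig_mx L -> (block_L1 L)^T *m pt = - block_li L -> a != mid_index j r ->
  (L^T *m col_mx pt (col_mx (1%:M : 'cV[F]_1) (0 : 'cV[F]_r))) a 0 = 0.
Proof.
move=> /is_trig_mxP trigL Lpt; rewrite mul_trmx_col_mid.
case: (split_ordP a) => [b|b] -> a_mid.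
  (* Leading block: the sum is entry [b] of [(block_L1 L)^T *m pt], and the extra term is entry [b]
     of [block_li L], so they cancel. *)
  have /matrixP/(_ b 0) := Lpt; rewrite !mxE => Lptb.
  apply/eqP; rewrite addr_eq0 -Lptb; apply/eqP.
  by apply: eq_bigr => c _; rewrite !mxE.
case: (split_ordP b) a_mid => [c|c] ->; first by rewrite ord1 eqxx.
(* Now [a] lies past the middle index, so all the entries of column [a] that remain are strictly
   above the diagonal of [L]. *)
move=> _; rewrite trigL ?addr0 /= ?addn0 ?ltn_add2l //; last first.
  by rewrite -[X in (X < _)%N]addn0 ltn_add2l.
by apply: big1 => d _; rewrite trigL ?mul0r //= ltn_addr.
Qed.

Theorem lemma2 (F : realType) (m n : nat)
    (H : 'M[F]_n) (A : 'M[F]_(m, n)) (R : 'M[F]_n)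
    (hH : sym_posdef H) (hR : cholesky_factor H R)
    (j r : nat) (W : {set 'I_m}) (w : 'I_(j + (1 + r)) -> 'I_m)
    (hW : enumerates W w)
    (L D : 'M[F]_(j + (1 + r))) (pt : 'cV[F]_j) :
  let M : 'M[F]_(m, n) := A *m invmx R in
  let Mk : 'M[F]_(j + (1 + r), n) := rowsub w M in
  let i : 'I_(j + (1 + r)) := mid_index j r in
  let p : 'cV[F]_(j + (1 + r)) :=
    col_mx pt (col_mx (1%:M : 'cV[F]_1) (0 : 'cV[F]_r)) in
  Mk *m Mk^T = L *m D *m L^T ->
  lower_unit_trig L ->
  is_diag_mx D ->
  D i i = 0 ->
  (block_L1 L)^T *m pt = - block_li L ->
  Mk *m Mk^T *m p = 0.
Proof.
move=> M Mk i p -> [trigL _] diagD Di Lpt.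
rewrite -!mulmxA [D *m _](_ : _ = 0) ?mulmx0 //.
apply/colP => a; rewrite mxE (bigD1 a) //= big1 => [|b b_a]; last first.
  by rewrite (is_diag_mxP diagD) ?mul0r // eq_sym.
(* What is left is [D a a] times entry [a] of [L^T *m p]: the first factor is zero at [i], the
   second everywhere else. *)
rewrite addr0 [RHS]mxE; have [->|a_i] := eqVneq a i; first by rewrite Di mul0r.
by rewrite trmx_col_mid_eq0 ?mulr0.
Qed.
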